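(* Let $a,b,s,h$ be positive integers with $s\ge 2$, $a,b\ge 2$ and $r=a+b\ge 5$. Then for every $C_0>0$ there exist $n_0>0$ and $C_1>0$ such that the following holds. If $n>n_0$ and $\mathcal H$ is an $n$-vertex $r$-uniform hypergraph on vertex set $[n]$ not containing the bush $\mathcal B_{s,h}(a,b)$ and with \[ |\mathcal H| > (s-1)\binom{n}{r-1} - C_0 n^{r-2}, \] then there are $s-1$ vertices in $[n]$ each of which is contained in at least $\binom{n}{r-1}-C_1 n^{r-2}$ edges of $\mathcal H$.
   Context: An $r$-uniform hypergraph is identified with its edge set. For positive integers $a,b,s,h$ with $s\ge2$ and $r=a+b$, the bush $\mathcal B_{s,h}(a,b)$ is the $r$-graph constructed as follows: take pairwise disjoint sets $A$ with $|A|=a$, $B_1,\dots,B_s$ with $|B_i|=b$, and $A_{i,j}$ ($i\in[s]$, $j\in[h]$) with $|A_{i,j}|=a$; its edges are $A\cup B_i$ for $i\in[s]$ and $B_i\cup A_{i,j}$ for $i\in[s]$, $j\in[h]$. ''$\mathcal H$ contains'' it means $\mathcal H$ has a subfamily isomorphic to it. *)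

(* Defs.v *)
From HB Require Import structures.
From mathcomp Require Import all_boot all_order all_algebra.
From mathcomp Require Import all_reals.

Set Implicit Arguments.
Unset Strict Implicit.
Unset Printing Implicit Defensive.

(* A hypergraph is identified with its edge set, a family of subsets of the
   finite vertex type V. *)
Definition hypergraph (V : finType) := {set {set V}}.

Definition uniform (V : finType) (r : nat) (H : hypergraph V) : Prop :=
  forall e : {set V}, e \in H -> #|e| = r.

(* Isomorphism along an injection of the whole vertex type of G; this is the
   usual notion when G has no isolated vertices (as for the bush below), and
   vertices of W outside the image are not constrained. *)
Definition isomorphic_copy (V W : finType) (G : hypergraph V)
    (F : hypergraph W) : Prop :=
  exists2 f : V -> W, injective f & F = [set f @: e | e : {set V} in G].

Definition contains (V W : finType) (H : hypergraph W) (G : hypergraph V) :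
    Prop :=
  exists2 F : hypergraph W, F \subset H & isomorphic_copy G F.

Definition degree (V : finType) (H : hypergraph V) (v : V) : nat :=
  #|[set e in H | v \in e]|.

(* The disjoint union of A, the B_i and the A_{i,j}. *)
Definition bush_vertex (a b s h : nat) : finType :=
  ('I_a + ('I_s * 'I_b) + ('I_s * 'I_h * 'I_a))%type.

Definition bush_A (a b s h : nat) : {set bush_vertex a b s h} :=
  [set (inl (inl x) : bush_vertex a b s h) | x : 'I_a].

Definition bush_B (a b s h : nat) (i : 'I_s) : {set bush_vertex a b s h} :=
  [set (inl (inr (i, y)) : bush_vertex a b s h) | y : 'I_b].

Definition bush_Aij (a b s h : nat) (i : 'I_s) (j : 'I_h) :
    {set bush_vertex a b s h} :=
  [set (inr (i, j, x) : bush_vertex a b s h) | x : 'I_a].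

Definition bush (a b s h : nat) : hypergraph (bush_vertex a b s h) :=
  [set bush_A a b s h :|: bush_B a b h i | i : 'I_s]
  :|: [set bush_B a b h i :|: bush_Aij a b i j | i : 'I_s, j : 'I_h].

(* Main.v *)
(** The Delta-system method.  By Furedi's theorem every r-graph has a positive
   proportion of its edges in an r-partite "homogeneous" subfamily F: there is
   an intersection-closed family JJ of proper subsets of the r colours such that
   for J in JJ the J-part of each edge is the kernel of a large sunflower in F,
   while for J outside JJ no two edges meet exactly in the J-part.  If |F| is
   more than n^(r-2), then every set of r-2 colours lies in a member of JJ, and
   since r >= 5 and a, b >= 2 either JJ contains two complementary sets of sizes
   a and b, which yields a bush, or there is a colour c such that JJ contains all
   proper sets through c.  Hence all but O(n^(r-2)) edges e of H have a vertex v
   in e such that every proper subset of e through v is a kernel; let G_v be the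
   family of these edges.

   For a set T of r-1 vertices let S(T) be the set of v outside T with T + v in
   G_v.  An a-set A contained in s edges of G_v for s different v outside A would
   yield a bush; hence |S(T)| <= s-1, and S(T) = S(T') if T and T' are both
   extremal (|S(T)| = s-1) and share a vertices.  By counting, all but O(n^(r-2)) sets T are
   extremal.  Exchanging the vertices of an ordered (r-1)-set x for those of y one
   at a time, all intermediate sets are extremal for all but O(n^(2r-3)) of the
   pairs (x, y), so S is constant outside O(n^(r-2)) sets T.  Its value is the
   required set of s-1 vertices. *)

Require Import Defs.
From mathcomp Require Import all_boot all_order all_algebra.
From mathcomp Require Import all_reals.
From mathcomp Require Import zify.
Import Order.TTheory GRing.Theory Num.Theory.

Set Implicit Arguments.
Unset Strict Implicit.
Unset Printing Implicit Defensive.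

(** * Elementary bounds on powers and falling factorials *)

Lemma ffact_le_expn n m : n ^_ m <= n ^ m.
Proof.
by elim: m => [|m IH]; rewrite ?ffactn0 // ffactnSr expnSr leq_mul // leq_subr.
Qed.

Lemma bin_le_expn n m : 'C(n, m) <= n ^ m.
Proof.
by apply: leq_trans (ffact_le_expn n m); rewrite -bin_ffact leq_pmulr // fact_gt0.
Qed.

(** The difference of the two powers counts the non-injective (m+1)-tuples, which are thus
    O(n^m). *)
Lemma expn_le_ffact n m : n ^ m.+1 <= n ^_ m.+1 + m.+1 ^ 2 * n ^ m.
Proof.
elim: m => [|m IH]; first by rewrite ffactn1 expn1 leq_addr.
rewrite expnS ffactnSr.
have := leq_mul (leqnn n) IH; have := ffact_le_expn n m.+1; rewrite (expnS n m).
have : n <= n - m.+1 + m.+1 by lia.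
move: (n - m.+1) (n ^_ m.+1) (n ^ m) => q f p; nia.
Qed.

(** * Sunflowers, disjoint representatives and matchings *)

Section Sunflowers.

Variable V : finType.
Implicit Types (F H P : {set {set V}}) (D X e p : {set V}) (k : nat).

(* The sunflower with kernel D is recorded by its petals, the edges minus D. *)
Definition kernel k F D :=
  [exists P : {set {set V}}, [&& k <= #|P|, trivIset P &
     [forall p in P, [disjoint p & D] && (D :|: p \in F)]]].

Lemma kernelP k F D :
  reflect (exists P, [/\ k <= #|P|, trivIset P &
             forall p, p \in P -> [disjoint p & D] /\ D :|: p \in F])
          (kernel k F D).
Proof.
apply: (iffP existsP) => -[P].
  case/and3P=> kP tP /forall_inP hP; exists P; split=> // p /hP.
  by case/andP.
case=> kP tP hP; exists P; rewrite kP tP; apply/forall_inP => p /hP [-> ->] //.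
Qed.

Lemma kernelS k F H D : F \subset H -> kernel k F D -> kernel k H D.
Proof.
move=> /subsetP FH /kernelP [P [kP tP hP]]; apply/kernelP; exists P; split=> //.
by move=> p /hP [dp /FH].
Qed.

(** If every member met [X], choosing a common point for each would inject [P] into [X]. *)
Lemma trivIset_avoid P X :
  trivIset P -> #|X| < #|P| -> exists2 p, p \in P & [disjoint p & X].
Proof.
move=> /trivIsetP tP ltXP.
apply/exists_inP; apply: contraT.
rewrite negb_exists_in => /forall_inP hP; exfalso.
have h p : p \in P -> exists2 x, x \in p & x \in X.
  by move=> /hP /pred0Pn [x /andP[xp xX]]; exists x.
pose g p := [pick x in p :&: X].
have gP p : p \in P -> exists2 x, g p = Some x & x \in p :&: X.
  move=> /h [y yp yX]; rewrite /g; case: pickP => [x xpX|/(_ y)]; first by exists x.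
  by rewrite inE yp yX.
have : #|g @: P| <= #|Some @: X|.
  apply/subset_leq_card/subsetP => y /imsetP [p /gP [x gx xpX] ->].
  by rewrite gx imset_f //; move: xpX; rewrite inE => /andP[].
rewrite card_imset; last by move=> ? ? [].
rewrite card_in_imset; first by rewrite leqNgt ltXP.
move=> p q pP qP; have [x gx xp] := gP p pP; have [y gy yq] := gP q qP.
rewrite gx gy => -[xy]; apply/eqP; apply: contraT => pq.
have /pred0P/(_ x)/= := tP _ _ pP qP pq.
by move: xp yq; rewrite -xy !inE => /andP[-> _] /andP[-> _].
Qed.

(** Greedy choice: each new set has to avoid [X] and fewer than [#|I|] earlier sets of size at most
    [c]. *)
Lemma disjoint_representatives (I : finType) (P : I -> {set {set V}}) X c :
  (forall i, trivIset (P i)) ->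
  (forall i p, p \in P i -> #|p| <= c) ->
  (forall i, #|X| + c * #|I| < #|P i|) ->
  exists f : I -> {set V},
    [/\ forall i, f i \in P i, forall i, [disjoint f i & X] &
        forall i j, i != j -> [disjoint f i & f j]].
Proof.
move=> tP cP lP.
have [f hf] : exists f : I -> {set V},
    forall i, i \in enum I -> [/\ f i \in P i, [disjoint f i & X] &
        forall j, j \in enum I -> i != j -> [disjoint f i & f j]].
  have : uniq (enum I) by apply: enum_uniq.
  have : size (enum I) <= #|I| by rewrite cardE.
  elim: (enum I) => [|i u IH]; first by exists (fun=> set0).
  move=> /= szu /andP[iu uu]; have [f hf] := IH (ltnW szu) uu.
  have [] := @trivIset_avoid (P i) (X :|: \bigcup_(j <- u) f j) (tP i).
    apply: leq_ltn_trans (lP i); apply: (leq_trans (leq_card_setU _ _)).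
    rewrite leq_add2l; apply: leq_trans (leq_mul (leqnn c) (ltnW szu)).
    elim: u {IH szu iu uu} hf => [|j u IH] hf; first by rewrite big_nil cards0.
    rewrite big_cons /= mulnS; apply: (leq_trans (leq_card_setU _ _)).
    apply: leq_add; first by have [/cP] := hf j (mem_head _ _).
    apply: IH => l lu; have [|h1 h2 h3] := hf l; first by rewrite inE lu orbT.
    by split=> // l' l'u; apply: h3; rewrite inE l'u orbT.
  move=> p pP pX; exists (fun j => if j == i then p else f j) => j.
  have pf l : l \in u -> [disjoint p & f l].
    move=> lu; apply: disjointWr pX; apply: subsetU; apply/orP; right.
    by rewrite (big_rem l) //= subsetUl.
  rewrite inE; case: eqP => [-> _|/eqP ji /= ju].
    split=> //; first by apply: disjointWr pX; apply: subsetUl.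
    move=> l; rewrite inE; case: eqP => [->|_] /=; first by rewrite eqxx.
    by move=> /pf.
  have [h1 h2 h3] := hf j ju; split=> // l; rewrite inE.
  case: eqP => [_ _ _|_ /= lu jl]; last exact: h3.
  by rewrite disjoint_sym pf.
exists f; split=> [i|i|i j]; have [|h1 h2 h3] := hf i => //; rewrite ?mem_enum //.
by apply: h3; rewrite mem_enum.
Qed.

(** The union of a matching that cannot be enlarged meets every edge. Excluding [set0] ensures that
    an edge disjoint from the matching is a new one. *)
Lemma matching_or_cover F r k :
  set0 \notin F -> (forall p, p \in F -> #|p| <= r) ->
  (exists P, [/\ P \subset F, trivIset P & k <= #|P|]) \/
  (exists X : {set V}, #|X| <= r * k /\ forall p, p \in F -> ~~ [disjoint p & X]).
Proof.
move=> F0 Fr; elim: k => [|k [[P [PF tP kP]]|[X [cX hX]]]].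
- left; exists set0; rewrite sub0set; split=> //.
  by apply/trivIsetP => A B; rewrite inE.
- case: (leqP k.+1 #|P|) => [kP'|Pk]; first by left; exists P.
  case: (boolP [exists p in F, [disjoint p & cover P]]).
    move=> /exists_inP [p pF dp]; left; exists (p |: P).
    have pP : p \notin P.
      apply: contra F0 => pP; suff <- : p = set0 by [].
      have /setIidPl <- : p \subset cover P by apply: (bigcup_sup p).
      exact: disjoint_setI0.
    split; last by rewrite cardsU1 pP.
      by rewrite subUset sub1set pF.
    apply/trivIsetP => A B; rewrite !inE.
    case/predU1P => [->|AP] /predU1P [->|BP]; rewrite ?eqxx // => AB.
    - by apply: disjointWr dp; apply: (bigcup_sup B).
    - by rewrite disjoint_sym; apply: disjointWr dp; apply: (bigcup_sup A).
    - by move/trivIsetP: tP; apply.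
  rewrite negb_exists_in => /forall_inP h; right; exists (cover P); split=> //.
  move: tP; rewrite /trivIset => /eqP <-.
  apply: leq_trans (leq_mul (leqnn r) (ltnW Pk)); rewrite mulnC -sum_nat_const.
  by apply: leq_sum => p /(subsetP PF) /Fr.
- by right; exists X; split=> //; rewrite mulnS (leq_trans cX) // leq_addl.
Qed.

Lemma subset_card_ex X c : c <= #|X| -> exists2 A : {set V}, A \subset X & #|A| = c.
Proof.
move=> cX; exists [set x in take c (enum X)].
  by apply/subsetP => x; rewrite inE => /mem_take; rewrite mem_enum.
rewrite cardsE; have /card_uniqP -> : uniq (take c (enum X)).
  by rewrite take_uniq // enum_uniq.
by rewrite size_take -cardE; case: ltngtP cX.
Qed.

Lemma set_param X c : #|X| = c ->
  exists2 g : 'I_c -> V, injective g & X = [set g i | i : 'I_c].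
Proof.
move=> <-; exists (@enum_val _ (mem X)); first exact: enum_val_inj.
apply/setP => x; apply/idP/imsetP => [xX|[i _ ->]]; last exact: enum_valP.
by exists (enum_rank_in xX x) => //; rewrite enum_rankK_in.
Qed.

End Sunflowers.

(** * Embedding the bush *)

(** Petals at the [B i] serve as the sets A_{i,j}. The bound on [k] lets [s * h] petals of size [a]
    avoid each other and the [a + s * b] vertices of [A] and the [B i]. *)
Lemma contains_bush (V : finType) (H : hypergraph V) (a b s h k : nat)
    (A : {set V}) (B : 'I_s -> {set V}) :
  0 < b -> uniform (a + b) H -> a + s * b + a * (s * h) < k ->
  #|A| = a -> (forall i, #|B i| = b) ->
  (forall i, [disjoint A & B i]) ->
  (forall i j, i != j -> [disjoint B i & B j]) ->
  (forall i, A :|: B i \in H) -> (forall i, kernel k H (B i)) ->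
  contains H (bush a b s h).
Proof.
move=> b0 uH lk cA cB AB BB ABH kB.
have [P hP] := fin_all_exists (fun i => kernelP k H (B i) (kB i)).
have cP i p : p \in P i -> #|p| = a.
  case: (hP i) => _ _ h1 /h1 [dp /uH].
  rewrite cardsU disjoint_setI0 1?disjoint_sym // cards0 cB; lia.
have [] := @disjoint_representatives V ('I_s * 'I_h)%type (fun i => P i.1) (A :|: \bigcup_i B i) a.
- by move=> i; case: (hP i.1).
- by move=> i p /cP ->.
- move=> i; case: (hP i.1) => kP _ _; apply: leq_trans kP; apply: leq_trans lk.
  rewrite ltnS card_prod !card_ord leq_add2r; apply: (leq_trans (leq_card_setU _ _)).
  rewrite cA leq_add2l.
  have -> : s * b = \sum_(i < s) #|B i|.
    by rewrite (eq_bigr (fun=> b)) // sum_nat_const card_ord.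
  elim/big_ind2 : _ => [|x X y Y hx hy|] //; first by rewrite cards0.
  by apply: (leq_trans (leq_card_setU _ _)); apply: leq_add.
move=> C [CP CX CC].
have [gA gAi eA] := set_param cA.
have [gB hB] := fin_all_exists2 (fun i => set_param (cB i)).
have [gC hC eC] := fin_all_exists2 (fun ij => set_param (cP ij.1 (C ij) (CP ij))).
pose f (x : bush_vertex a b s h) : V :=
  match x with
  | inl (inl x) => gA x
  | inl (inr iy) => gB iy.1 iy.2
  | inr jx => gC jx.1 jx.2
  end.
move=> eB.
have fA x : gA x \in A by rewrite eA imset_f.
have fB i x : gB i x \in B i by rewrite eB imset_f.
have fC i x : gC i x \in C i by rewrite eC imset_f.
have dj (X Y : {set V}) x y : [disjoint X & Y] -> x \in X -> y \in Y -> x <> y.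
  by move=> /disjointFr dXY /dXY + yY xy; rewrite xy yY.
have CA ij : [disjoint C ij & A] by apply: disjointWr (CX ij); apply: subsetUl.
have CB ij i : [disjoint C ij & B i].
  apply: disjointWr (CX ij); apply: subsetU; apply/orP; right.
  exact: (bigcup_sup i).
exists [set f @: e | e : {set bush_vertex a b s h} in bush a b s h]; last first.
  exists f => // -[[x|[i x]]|[ij x]] [[y|[i' y]]|[ij' y]] /= E.
  - by rewrite (gAi _ _ E).
  - by case: (dj _ _ _ _ (AB i') (fA x) (fB i' y) E).
  - by case: (dj _ _ _ _ (CA ij') (fC ij' y) (fA x) (esym E)).
  - by case: (dj _ _ _ _ (AB i) (fA y) (fB i x) (esym E)).
  - case: (eqVneq i i') => [ii'|ii'].
      by move: x y E; rewrite ii' => x y /hB ->.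
    by case: (dj _ _ _ _ (BB _ _ ii') (fB i x) (fB i' y) E).
  - by case: (dj _ _ _ _ (CB ij' i) (fC ij' y) (fB i x) (esym E)).
  - by case: (dj _ _ _ _ (CA ij) (fC ij x) (fA y) E).
  - by case: (dj _ _ _ _ (CB ij i') (fC ij x) (fB i' y) E).
  - case: (eqVneq ij ij') => [ii'|ii'].
      by move: x y E; rewrite ii' => x y /hC ->.
    by case: (dj _ _ _ _ (CC _ _ ii') (fC ij x) (fC ij' y) E).
have iA : f @: bush_A a b s h = A by rewrite -imset_comp eA.
have iB i : f @: bush_B a b h i = B i by rewrite -imset_comp eB.
have iC i j : f @: bush_Aij a b i j = C (i, j) by rewrite -imset_comp eC.
apply/subsetP => _ /imsetP [e + ->]; rewrite inE => /orP[].
  by case/imsetP=> i _ ->; rewrite imsetU iA iB.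
case/imset2P=> i j _ _ ->; rewrite imsetU iB iC.
by case: (hP i) => _ _ /(_ _ (CP (i, j))) [].
Qed.

(** * Furedi's theorem on homogeneous subfamilies *)

(** Averaging over all colourings: prescribing one bijection on an edge already yields r^(|V|-r)
    colourings that are injective on it. *)
Lemma rainbow_subfamily (V : finType) (r : nat) (F : {set {set V}}) :
  0 < r -> (forall e, e \in F -> #|e| = r) ->
  exists chi : {ffun V -> 'I_r},
    #|F| <= r ^ r * #|[set e in F | dinjectiveb chi e]|.
Proof.
move=> r0 uF.
pose N (chi : {ffun V -> 'I_r}) := #|[set e in F | dinjectiveb chi e]|.
have i0 : 'I_r by exists 0.
case: (boolP [exists chi, #|F| <= r ^ r * N chi]) => [/existsP //|].
rewrite negb_exists => /forallP hN; exfalso.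
have le1 e : e \in F ->
    r ^ #|V| <= r ^ r * #|[set chi : {ffun V -> 'I_r} | dinjectiveb chi e]|.
  move=> eF; have ce := uF e eF.
  have [g gi eg] := set_param ce.
  pose G x : pred 'I_r := if [pick i | g i == x] is Some i then pred1 i else predT.
  have le2 : #|family G| <= #|[set chi : {ffun V -> 'I_r} | dinjectiveb chi e]|.
    apply/subset_leq_card/subsetP => chi /familyP hG; rewrite inE.
    apply/dinjectiveP; rewrite eg => _ _ /imsetP [i _ ->] /imsetP [j _ ->].
    move: (hG (g i)) (hG (g j)); rewrite /G.
    case: pickP => [i' /eqP /gi ->|/(_ i)]; last by rewrite eqxx.
    case: pickP => [j' /eqP /gi ->|/(_ j)]; last by rewrite eqxx.
    by rewrite !inE => /eqP -> /eqP -> ->.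
  apply: leq_trans (leq_mul (leqnn _) le2).
  rewrite card_family foldrE big_image /=.
  rewrite (bigID (mem e)) /= [X in _ <= _ * (X * _)]big1 => [|x]; last first.
    rewrite eg => /imsetP [i _ ->]; rewrite /G; case: pickP => [j _|/(_ i)].
      by rewrite card1.
    by rewrite eqxx.
  rewrite mul1n (eq_bigr (fun=> r)) => [|x xe]; last first.
    rewrite /G; case: pickP => [i /eqP gx|_]; last by rewrite card_ord.
    by move: xe; rewrite eg -gx imset_f.
  rewrite prod_nat_const -expnD leq_pexp2l // -{1}ce.
  by have <- := cardC (mem e); rewrite leq_add2l; apply/eq_leq/eq_card => x; rewrite !inE.
(* Strictness of the sum needs at least one colouring; the constant one exists since [r] is
   positive. *)
have : \sum_(chi : {ffun V -> 'I_r}) r ^ r * N chi < \sum_(chi : {ffun V -> 'I_r}) #|F|.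
  have c0 : [ffun=> i0] \in [set: {ffun V -> 'I_r}] by rewrite inE.
  rewrite (bigD1 [ffun=> i0]) // [X in _ < X](bigD1 [ffun=> i0]) //=.
  rewrite -addSn; apply: leq_add; first by rewrite ltnNge hN.
  by apply: leq_sum => chi _; apply: ltnW; rewrite ltnNge hN.
rewrite sum_nat_const card_ffun card_ord ltnNge => /negP; apply.
rewrite mulnC -sum_nat_const -big_distrr /=.
apply: (@leq_trans (\sum_(e in F) r ^ r *
    \sum_(chi : {ffun V -> 'I_r} | dinjectiveb chi e) 1)).
  by apply: leq_sum => e /le1; rewrite sum1dep_card.
rewrite -big_distrr leq_mul2l; apply/orP; right.
rewrite (exchange_big_dep predT) //=; apply: leq_sum => chi _.
by rewrite sum1dep_card /N; apply: subset_leq_card; apply/subsetP => e; rewrite !inE.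
Qed.

Section Homogeneous.

Variables (V : finType) (r k : nat) (chi : V -> 'I_r).

Implicit Types (F G M : {set {set V}}) (e p D : {set V}) (J : {set 'I_r})
  (JJ : {set {set 'I_r}}).

(** Each colour occurs exactly once on every edge, so [F] is r-partite with the colour classes as
    parts. *)
Definition rainbow F := forall e, e \in F -> #|e| = r /\ {in e &, injective chi}.

Definition proj e J := [set x in e | chi x \in J].

Definition sparse F J := forall e e', e \in F -> e' \in F -> e != e' ->
  e :&: e' != proj e J.

Definition saturated JJ F :=
  forall e J, e \in F -> J \in JJ -> kernel k F (proj e J).

Lemma rainbowS F G : F \subset G -> rainbow G -> rainbow F.
Proof. by move=> /subsetP FG rG e /FG /rG. Qed.

Lemma proj_sub e J : proj e J \subset e.
Proof. by apply/subsetP => x; rewrite inE => /andP[]. Qed.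

Lemma chi_onto F e : rainbow F -> e \in F -> chi @: e = setT.
Proof.
move=> rF /rF [ce ie]; apply/eqP; rewrite eqEcard subsetT cardsT card_ord.
by rewrite card_in_imset ?ce /=.
Qed.

Lemma chi_proj F e J : rainbow F -> e \in F -> chi @: proj e J = J.
Proof.
move=> rF eF; apply/setP => i; apply/imsetP/idP => [[x]|iJ].
  by rewrite inE => /andP[_ cJ] ->.
have /imsetP [x xe ix] : i \in chi @: e by rewrite (chi_onto rF eF) inE.
by exists x => //; rewrite inE xe -ix.
Qed.

Lemma card_proj F e J : rainbow F -> e \in F -> #|proj e J| = #|J|.
Proof.
move=> rF eF; rewrite -{2}(chi_proj J rF eF) card_in_imset // => x y.
by rewrite !inE => /andP[xe _] /andP[ye _]; apply: (rF e eF).2.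
Qed.

Lemma proj_chi F e D : rainbow F -> e \in F -> D \subset e -> D = proj e (chi @: D).
Proof.
move=> rF eF De; apply/setP => x; rewrite inE; apply/idP/andP => [xD|[xe]].
  by rewrite (subsetP De) // imset_f.
case/imsetP => y yD cxy; suff -> : x = y by [].
by apply: (rF e eF).2 => //; apply: (subsetP De).
Qed.

Lemma proj_eq F e e' J : rainbow F -> e \in F -> e' \in F ->
  proj e J \subset e' -> proj e' J = proj e J.
Proof.
move=> rF eF eF' s; apply/esym/eqP; rewrite eqEcard !(card_proj J rF) // leqnn andbT.
by apply/subsetP => x xe; move: (xe) (subsetP s x xe); rewrite !inE => /andP[_ ->] ->.
Qed.

(* Edges violating saturation are removed one at a time and filed under the
   offending J.  When e is filed, its J-part is not a kernel among the edges
   still present, which include all edges filed later. *)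
Lemma saturated_peel JJ F : rainbow F ->
  exists M, [/\ M \subset F, saturated JJ M &
    exists G : {set 'I_r} -> {set {set V}},
    [/\ forall e, e \in F -> e \in M \/ exists2 J, J \in JJ & e \in G J,
        forall J, G J \subset F &
        forall J e, J \in JJ -> e \in G J -> ~~ kernel k (G J) (proj e J)]].
Proof.
have [n leFn] := ubnP #|F|; elim: n F leFn => // n IH F /ltnSE leFn rF.
case: (boolP [forall e in F, forall J in JJ, kernel k F (proj e J)]).
  move=> /forall_inP sF; exists F; split=> //.
    by move=> e J /sF /forall_inP; apply.
  by exists (fun=> set0); split=> [e|J|J e]; rewrite ?sub0set ?inE //; left.
rewrite negb_forall_in => /exists_inP [e eF].
rewrite negb_forall_in => /exists_inP [J JJJ nk].
have sF : F :\ e \subset F by apply: subsetDl.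
have [|M [MF sM [G [G1 G2 G3]]]] := IH (F :\ e) _ (rainbowS sF rF).
  by rewrite (cardsD1 e) eF add1n in leFn.
exists M; split=> //; first exact: subset_trans sF.
pose G' I := if I == J then e |: G J else G I.
have G'F I : G' I \subset F.
  rewrite /G'; case: eqP => _; last exact: subset_trans (G2 I) sF.
  by rewrite subUset sub1set eF (subset_trans (G2 J) sF).
exists G'; split=> //.
  move=> e' e'F; case: (eqVneq e' e) => [->|ne].
    by right; exists J => //; rewrite /G' eqxx setU11.
  have [||[I II eI]] := G1 e'; rewrite ?inE ?ne //; first by left.
  right; exists I => //; rewrite /G'; case: eqP => [<-|_] //.
  by rewrite inE eI orbT.
move=> I e' II; case: (eqVneq I J) => [->|IJ]; last first.
  by rewrite /G' (negPf IJ); apply: G3.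
(* An edge with the J-part of [e] inherits the failure in [F]. Otherwise [e] does not contain the
   J-part of [e'], so adding [e] creates no sunflower with that kernel. *)
case: (eqVneq (proj e' J) (proj e J)) => [->|ne] e'G.
  by apply: contra nk; apply: kernelS; apply: G'F.
have e'F := subsetP (G'F J) _ e'G.
have e'GJ : e' \in G J.
  by move: e'G ne; rewrite /G' eqxx !inE => /predU1P [->|//]; rewrite eqxx.
apply: contra (G3 J e' JJJ e'GJ) => /kernelP [P [kP tP hP]].
apply/kernelP; exists P; split=> // p /hP [dp]; rewrite /G' eqxx !inE.
case/predU1P=> [pe|pG]; split=> //.
by rewrite (proj_eq rF e'F eF) ?eqxx // -pe subsetUl in ne.
Qed.

(** Each edge has an incidence with [X :\: A], which has at most [c] points, so some point has the
    average share. *)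
Lemma popular_point (A : {set V}) G (X : {set V}) c :
  0 < #|G| -> #|X| <= c ->
  (forall e, e \in G -> ~~ [disjoint e :\: A & X]) ->
  exists x, (x \notin A) && (#|G| <= c * #|[set e in G | x \in e]|).
Proof.
move=> G0 cX hX; apply/existsP; apply: contraT; rewrite negb_exists => /forallP h.
have lt x : x \in X :\: A -> c * #|[set e in G | x \in e]| <= #|G|.-1.
  rewrite inE => /andP[xA _]; move: (h x); rewrite xA /= -ltnNge => lt1.
  by rewrite -ltnS prednK.
have le1 : #|G| <= \sum_(x in X :\: A) #|[set e in G | x \in e]|.
  apply: (@leq_trans (\sum_(x in X :\: A) \sum_(e in G | x \in e) 1)); last first.
    by apply: leq_sum => x _; rewrite sum1dep_card.
  rewrite (exchange_big_dep (mem G)) /=; last by move=> ? ? _ /andP[].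
  rewrite -sum1_card; apply: leq_sum => e eG; rewrite sum1dep_card.
  have /pred0Pn [x /= /andP[xe xX]] := hX e eG.
  move: xe; rewrite inE => /andP[xA xe].
  by apply/card_gt0P; exists x; rewrite !inE xX xA xe eG.
have c0 : 0 < c.
  apply: leq_trans cX; have [e eG] := card_gt0P G0.
  by have /pred0Pn [x /= /andP[_ xX]] := hX e eG; apply/card_gt0P; exists x.
have : c * #|G| <= c * #|G|.-1.
  apply: leq_trans (leq_mul (leqnn c) le1) _; rewrite big_distrr /=.
  apply: (@leq_trans (\sum_(x in X :\: A) #|G|.-1)); first exact: leq_sum.
  rewrite sum_nat_const leq_mul2r (leq_trans _ cX) ?orbT //.
  exact: subset_leq_card (subsetDl X A).
rewrite leq_mul2l; move: c0 G0; case: (c) => [|?] // _; case: #|G| => // m _ /=; lia.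
Qed.

(* The edges of G with a given J-part A have no large sunflower with kernel A, so
   outside A they are covered by few points; keeping those through a popular
   point x(A) makes any two of them meet outside A. *)
Lemma sparsify G J : rainbow G -> J != setT ->
  (forall e, e \in G -> ~~ kernel k G (proj e J)) ->
  exists G', [/\ G' \subset G, #|G| <= r * k * #|G'| & sparse G' J].
Proof.
move=> rG JT nk.
pose GA (A : {set V}) := [set e in G | proj e J == A].
pose good (A : {set V}) x := (x \notin A) && (#|GA A| <= r * k * #|[set e in GA A | x \in e]|).
have hx (A : {set V}) : 0 < #|GA A| -> exists x, good A x.
  move=> GA0; have [e0] := card_gt0P GA0; rewrite inE => /andP[e0G /eqP eA].
  pose L := [set e :\: A | e in GA A].
  (* Since [J] is not the full colour set, every edge has a vertex outside its J-part. *)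
  have L0 : set0 \notin L.
    apply/imsetP => -[e]; rewrite inE => /andP[eG /eqP pe] /esym/eqP.
    rewrite setD_eq0 -pe => /subset_leq_card.
    rewrite (card_proj J rG eG) (rG e eG).1 leqNgt => /negP; apply.
    have /proper_card : J \proper setT by rewrite properE subsetT subTset.
    by rewrite cardsT card_ord.
  have Lr p : p \in L -> #|p| <= r.
    case/imsetP => e; rewrite inE => /andP[eG _] ->.
    by rewrite -(rG e eG).1 subset_leq_card // subsetDl.
  have [[P [PL tP kP]]|[X [cX hX]]] := matching_or_cover k L0 Lr.
    case/negP: (nk e0 e0G); apply/kernelP; exists P; split=> // p.
    move=> /(subsetP PL) /imsetP [e]; rewrite inE => /andP[eG /eqP pe] ->.
    rewrite eA; split; first by rewrite disjoint_sym disjoints_subset setCD subsetUr.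
    suff -> : A :|: e :\: A = e by [].
    have /setIidPr Ae : A \subset e by rewrite -pe proj_sub.
    by rewrite -{1}Ae setID.
  by apply: (popular_point GA0 cX) => e eG; apply: hX; apply: imset_f.
pose G' := [set e in G | if [pick x | good (proj e J) x] is Some x then x \in e else false].
exists G'; split.
- by apply/subsetP => e; rewrite inE => /andP[].
- rewrite -!sum1_card (partition_big (fun e => proj e J) predT) //=.
  rewrite [X in _ <= _ * X](partition_big (fun e => proj e J) predT) //=.
  rewrite big_distrr /=; apply: leq_sum => A _; rewrite !sum1dep_card.
  case: (posnP #|GA A|) => [->//|/hx [x0 gx0]].
  case E: [pick x | good A x] => [x|]; last first.
    by move: E; case: pickP => // /(_ x0); rewrite gx0.
  have [_ le] : x \notin A /\ #|GA A| <= r * k * #|[set e in GA A | x \in e]|.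
    by move: E; case: pickP => // y /andP[h1 h2] [<-].
  apply: leq_trans le _; rewrite leq_mul2l; apply/orP; right.
  apply/subset_leq_card/subsetP => e; rewrite !inE => /andP[/andP[-> /eqP pe]].
  by rewrite pe E eqxx => ->.
- move=> e e'; rewrite !inE => /andP[eG xe] /andP[e'G xe'] ne.
  apply/negP => /eqP ee'; move: xe' xe; rewrite (proj_eq rG eG e'G); last first.
    by rewrite -ee' subsetIr.
  case: pickP => // x /andP[xA _] xe' xe.
  by move: xA; rewrite -ee' inE xe xe'.
Qed.

(* Furedi's theorem, by induction on the family JJ of the colour sets that are not
   yet sparse. *)
Lemma homogeneous_subfamily F JJ : rainbow F -> setT \notin JJ ->
  (forall J, J \notin JJ -> sparse F J) ->
  exists F' JJ', [/\ F' \subset F, #|F| <= (2 ^ r.+1 * (r * k)).+2 ^ #|JJ| * #|F'|,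
    setT \notin JJ', saturated JJ' F' & forall J, J \notin JJ' -> sparse F' J].
Proof.
have [n] := ubnP #|JJ|; elim: n F JJ => // n IH F JJ /ltnSE leJ rF nT sp.
(* The loss per round; the additive 2 pays for the case where [M] keeps at least half of [F]. *)
set c := (_).+2.
have [M [MF sM [G [G1 G2 G3]]]] := saturated_peel JJ rF.
case: (leqP #|F| (2 * #|M|)) => [leFM|ltMF].
  (* For empty [JJ] the exponent is 0 and leaves no room for a factor 2, but then [F] itself is
     saturated. *)
  case: (posnP #|JJ|) => [/eqP|JJ0].
    rewrite cards_eq0 => /eqP J0; exists F, JJ; split=> //.
      by rewrite leq_pmull ?expn_gt0.
    by move=> e J; rewrite J0 inE.
  exists M, JJ; split=> //.
    apply: leq_trans leFM _; rewrite leq_mul2r; apply/orP; right.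
    by rewrite -(prednK JJ0) expnS; apply: (@leq_mul 2 1) => //; rewrite expn_gt0.
  move=> J /sp sJ e e' eM e'M; apply: sJ; exact: (subsetP MF).
(* More than half of [F] is filed under at most 2^r colour sets. *)
have [J JJJ leG] : exists2 J, J \in JJ & #|F| <= 2 ^ r.+1 * #|G J|.
  apply/exists_inP; apply: contraT; rewrite negb_exists_in => /forall_inP h.
  have leFG : #|F| <= #|M| + \sum_(J in JJ) #|G J|.
    have : F \subset M :|: \bigcup_(J in JJ) G J.
      apply/subsetP => e /G1 [eM|[J JJJ eJ]]; rewrite inE ?eM //.
      by apply/orP; right; apply/bigcupP; exists J.
    move=> /subset_leq_card le; apply: (leq_trans le).
    apply: (leq_trans (leq_card_setU _ _)); rewrite leq_add2l.
    elim/big_ind2 : _ => [|x X y Y hx hy|] //; first by rewrite cards0.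
    by apply: (leq_trans (leq_card_setU _ _)); apply: leq_add.
  have lt J : J \in JJ -> 2 ^ r.+1 * #|G J| <= #|F|.-1.
    by move=> /h; rewrite -ltnNge; case: #|F|.
  have cJ : #|JJ| <= 2 ^ r.
    by apply: leq_trans (max_card _) _; rewrite -cardsT -powersetT card_powerset cardsT card_ord.
  have : 2 ^ r * (2 * \sum_(J in JJ) #|G J|) <= 2 ^ r * #|F|.-1.
    rewrite mulnA -(mulnC 2) -expnS big_distrr /=.
    apply: (@leq_trans (\sum_(J in JJ) #|F|.-1)); first exact: leq_sum.
    by rewrite sum_nat_const leq_mul2r cJ orbT.
  rewrite leq_pmul2l ?expn_gt0 //; lia.
have JT : J != setT by apply: contraNneq nT => <-.
have [G' [G'G leG' sG']] := sparsify (rainbowS (G2 J) rF) JT (fun e => G3 J e JJJ).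
have G'F := subset_trans G'G (G2 J).
have [||||F' [JJ' [F'G' leF' nT' sF' spF']]] := IH G' (JJ :\ J).
- by move: leJ; rewrite (cardsD1 J) JJJ.
- exact: rainbowS G'F rF.
- by rewrite inE negb_and nT orbT.
- move=> I; rewrite !inE negb_and negbK => /orP[/eqP -> //|/sp sI] e e' eG e'G.
  by apply: sI; apply: (subsetP G'F).
exists F', JJ'; split=> //; first exact: subset_trans F'G' G'F.
rewrite (cardsD1 J) JJJ expnS -mulnA.
apply: leq_trans leG _; apply: leq_trans (leq_mul (leqnn _) leG') _.
rewrite mulnA; apply: leq_mul => //; rewrite /c.
by apply: leqW; apply: leqW.
Qed.

(** Replace [e] outside its J1-part by a petal avoiding [e], then outside its J2-part by a petal
    avoiding the first new edge. The two new edges meet exactly in the part of [J1 :&: J2], so this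
    set is not sparse; they differ because [J1] is not full. *)
Lemma saturated_setI F JJ J1 J2 : r < k -> rainbow F -> 0 < #|F| -> setT \notin JJ ->
  saturated JJ F -> (forall J, J \notin JJ -> sparse F J) ->
  J1 \in JJ -> J2 \in JJ -> J1 :&: J2 \in JJ.
Proof.
move=> rk rF /card_gt0P [e eF] nT sF sp J1J J2J; apply: contraT => /sp spI.
have petal J D : J \in JJ -> D \in F ->
    exists p, [disjoint p & D] /\ proj e J :|: p \in F.
  move=> JJJ DF; have /kernelP [P [kP tP hP]] := sF e J eF JJJ.
  have [|p pP dp] := @trivIset_avoid _ P D tP.
    by rewrite (rF _ DF).1 (leq_trans rk).
  by exists p; case: (hP p pP).
have [p1 [dp1 e1F]] := petal _ _ J1J eF.
have [p2 [dp2 e2F]] := petal _ _ J2J e1F.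
have eI : (proj e J1 :|: p1) :&: (proj e J2 :|: p2) = proj e (J1 :&: J2).
  apply/setP => x; have := disjointFl dp1 (x := x); have := disjointFr dp2 (x := x).
  rewrite !inE; case: (x \in e) => /=; case: (x \in p1); case: (x \in p2);
    case: (chi x \in J1); case: (chi x \in J2) => //= h1 h2;
    do ?[by rewrite h1 | by rewrite h2].
have sub1 : proj e (J1 :&: J2) \subset proj e J1 :|: p1 by rewrite -eI subsetIl.
have := spI _ _ e1F e2F; rewrite (proj_eq rF eF e1F sub1) eI eqxx; apply.
apply: contra nT => /eqP e12; move: eI; rewrite -e12 setIid => eI.
suff <- : J1 = setT by [].
apply/eqP; rewrite eqEcard subsetT cardsT card_ord /=.
rewrite -{1}(rF _ e1F).1 eI (card_proj _ rF eF).
exact: subset_leq_card (subsetIl _ _).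
Qed.

(** Edges are determined by their T-parts: two edges sharing one would meet in a J-part with [J] in
    [JJ] containing [T]. *)
Lemma uncovered_bound F JJ (T : {set 'I_r}) : rainbow F ->
  (forall J, J \notin JJ -> sparse F J) ->
  (forall J, J \in JJ -> ~~ (T \subset J)) -> #|F| <= 'C(#|V|, #|T|).
Proof.
move=> rF sp nT; rewrite -card_draws -(@card_in_imset _ _ (fun e => proj e T) (mem F)).
  apply/subset_leq_card/subsetP => _ /imsetP [e eF ->].
  by rewrite inE (card_proj T rF eF).
move=> e e' eF e'F pe; apply/eqP; apply: contraT => ne.
pose J := chi @: (e :&: e').
have pJ : e :&: e' = proj e J by apply: (proj_chi rF eF); apply: subsetIl.
have : J \in JJ by apply: contraT => /sp /(_ _ _ eF e'F ne); rewrite pJ eqxx.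
move=> /nT /negP []; rewrite -(chi_proj T rF eF); apply: imsetS.
by rewrite subsetI proj_sub pe proj_sub.
Qed.

End Homogeneous.

(** * Intersection-closed families of colour sets *)

(** The colours [i] with [[set~ i]] outside [JJ] decide. A single such colour is the centre [c];
    otherwise some a-set and its complement both contain a number of them other than 1. *)
Lemma intersection_closed_dichotomy (a b r : nat) (JJ : {set {set 'I_r}}) :
  1 < a -> 1 < b -> r = a + b -> 4 < r ->
  setT \notin JJ ->
  (forall J1 J2, J1 \in JJ -> J2 \in JJ -> J1 :&: J2 \in JJ) ->
  (forall T : {set 'I_r}, #|T| = r - 2 -> exists2 J : {set 'I_r}, J \in JJ & T \subset J) ->
  (exists J : {set 'I_r}, [/\ #|J| = a, J \in JJ & ~: J \in JJ]) \/
  (exists c, forall J : {set 'I_r}, c \in J -> J != setT -> J \in JJ).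
Proof.
move=> a1 b1 rab r5 nT cI cov.
(* The complement of a nonempty X belongs to JJ unless X meets N in one point. *)
pose N : {set 'I_r} := [set i | [set~ i] \notin JJ].
(* Of the four sets containing [~: [set i; j]], only this set itself can be in [JJ]. *)
have pairN (i j : 'I_r) : i \in N -> j \in N -> i != j -> ~: [set i; j] \in JJ.
  rewrite !inE => iN jN ij.
  have [|J JJJ sJ] := cov (~: [set i; j]).
    have := cardsC [set i; j]; rewrite cards2 ij card_ord /= => h.
    by apply/eqP; rewrite -(eqn_add2l 2) h subnKC //; lia.
  suff <- : J = ~: [set i; j] by [].
  have hi : i \notin J.
    apply/negP => iJ; case: (boolP (j \in J)) => jJ.
      case/negP: nT; suff <- : J = setT by [].
      apply/setP => x; rewrite inE; case: (eqVneq x i) => [->//|xi].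
      case: (eqVneq x j) => [->//|xj].
      by apply: (subsetP sJ); rewrite !inE (negPf xi) (negPf xj).
    case/negP: jN; suff <- : J = [set~ j] by [].
    apply/setP => x; rewrite !inE; case: (eqVneq x j) => [->|xj]; first exact/negbTE.
    case: (eqVneq x i) => [->//|xi].
    by apply: (subsetP sJ); rewrite !inE (negPf xi) (negPf xj).
  have hj : j \notin J.
    apply/negP => jJ.
    case/negP: iN; suff <- : J = [set~ i] by [].
    apply/setP => x; rewrite !inE; case: (eqVneq x i) => [->|xi]; first exact/negbTE.
    case: (eqVneq x j) => [->//|xj].
    by apply: (subsetP sJ); rewrite !inE (negPf xi) (negPf xj).
  apply/eqP; rewrite eqEsubset sJ andbT; apply/subsetP => x xJ.
  by rewrite !inE; apply/norP; split; apply: contraTneq xJ => ->.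
(* Induction on [#|X|]: a colour outside [N] is split off; inside [N], a set of three or more
   colours is the union of two smaller ones, and pairs come from [pairN]. *)
have main (X : {set 'I_r}) : X != set0 -> #|X :&: N| != 1 -> ~: X \in JJ.
  have [n] := ubnP #|X|; elim: n X => // n IH X /ltnSE cX X0 XN.
  case: (boolP (X \subset N)) => [sXN|/subsetPn [i iX iN]].
    move: XN; rewrite (setIidPl sXN) => cX1.
    have cX2 : 1 < #|X| by rewrite ltn_neqAle eq_sym cX1 card_gt0.
    have [i [j [iX jX ij]]] := card_gt1P cX2.
    have [iN jN] := (subsetP sXN i iX, subsetP sXN j jX).
    case: (ltngtP #|X| 2) => [|cX3|cX3]; first by rewrite ltnNge cX2.
      have E : ~: X = ~: (X :\ i) :&: ~: (X :\ j).
        rewrite -setCU; congr (~: _); apply/setP => x; rewrite !inE.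
        case: eqP => [->|_] /=; last by case: (x \in X); rewrite ?andbF.
        by rewrite ij iX.
      have sub l : X :\ l \subset N by apply: subset_trans sXN; apply: subsetDl.
      have cd l : l \in X -> #|X| = (#|X :\ l|).+1 by move=> lX; rewrite (cardsD1 l X) lX.
      have ok l : l \in X -> ~: (X :\ l) \in JJ.
        move=> /cd cl; apply: IH; first by rewrite -cl.
          by rewrite -card_gt0; move: cX3; rewrite cl; case: #|_|.
        rewrite (setIidPl (sub l)); move: cX3; rewrite cl; lia.
      by rewrite E; apply: cI; apply: ok.
    suff -> : X = [set i; j] by apply: pairN.
    apply/esym/eqP; rewrite eqEcard cards2 ij cX3 leqnn andbT.
    by rewrite subUset !sub1set iX jX.
  case: (eqVneq X [set i]) => [->|Xi].
    by move: iN; rewrite inE negbK.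
  have -> : ~: X = [set~ i] :&: ~: (X :\ i).
    rewrite -setCU; congr (~: _); apply/setP => x; rewrite !inE.
    by case: eqP => [->|]; rewrite ?iX.
  apply: cI; first by move: iN; rewrite inE negbK.
  have IN : (X :\ i) :&: N = X :&: N.
    apply/setP => x; rewrite 2!in_setI in_setD1; case: eqP => [->|//].
    by rewrite (negPf iN) !andbF.
  apply: IH; rewrite ?IN //.
    by apply: leq_trans cX; rewrite [X in _ < X](cardsD1 i X) iX.
  apply: contra Xi; rewrite setD_eq0 subset1 (negPf X0) orbF.
  by move=> /eqP ->.
case: (eqVneq #|N| 1) => [/eqP/cards1P [c Nc]|N1].
  right; exists c => J cJ JT; rewrite -(setCK J); apply: main.
    by apply: contra JT => /eqP E; rewrite -(setCK J) E setC0.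
  suff -> : ~: J :&: N = set0 by rewrite cards0.
  apply/setP => x; rewrite Nc !inE; case: eqP => [->|]; rewrite ?andbF //.
  by rewrite cJ.
left.
have leN : #|N| <= r by rewrite -[X in _ <= X](card_ord r) max_card.
(* [x] is the number of colours of [N] in the a-set. For [#|N| = 3] and [a = 2] the choice 0 works
   because [r >= 5] gives [b >= 3]. *)
have [x [x1 xN xa xr Nx]] : exists x, [/\ x != 1, x <= #|N|, x <= a,
    a - x <= r - #|N| & #|N| - x != 1].
  case: (ltnP 3 #|N|) => [N4|N4].
    case: (leqP (#|N| - 2) b) => h; first by exists 2; split=> //; lia.
    by exists (#|N| - b); split; lia.
  case: (eqVneq #|N| 0) => N0; first by exists 0; split=> //; lia.
  case: (eqVneq #|N| 2) => N2; first by exists 2; split=> //; lia.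
  case: (leqP 3 a) => h; first by exists 3; split=> //; lia.
  by exists 0; split=> //; lia.
have [A1 sA1 cA1] := subset_card_ex xN.
have cCN : #|~: N| = r - #|N| by have := cardsC N; rewrite card_ord; lia.
have [|A2 sA2 cA2] := @subset_card_ex _ (~: N) (a - x); first by rewrite cCN.
have d12 : A1 :&: A2 = set0.
  apply: disjoint_setI0; apply: disjointWl sA1 _; rewrite disjoint_sym.
  by rewrite disjoints_subset.
have cA : #|A1 :|: A2| = a by rewrite cardsU d12 cards0 cA1 cA2; lia.
have AN : (A1 :|: A2) :&: N = A1.
  rewrite setIUl (setIidPl sA1); suff -> : A2 :&: N = set0 by rewrite setU0.
  by apply: disjoint_setI0; rewrite disjoints_subset.
exists (A1 :|: A2); split=> //.
- rewrite -(setCK (_ :|: _)); apply: main.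
    rewrite -card_gt0; have := cardsC (A1 :|: A2); rewrite cA card_ord; lia.
  rewrite setIC -setDE cardsD setIC AN cA1; lia.
- apply: main; last by rewrite AN cA1.
  by rewrite -card_gt0 cA; lia.
Qed.

(** * Rich edges and their centres *)

Section Rich.

Variables (V : finType) (k : nat).
Implicit Types (F H : {set {set V}}) (v : V) (D e : {set V}).

Definition rich v F :=
  [forall e in F, (v \in e) &&
    [forall D : {set V}, (v \in D) && (D \proper e) ==> kernel k F D]].

(** The largest rich subfamily, G_v in the idea of the proof: [rich] looks for kernels in [F]
    itself, and these persist in unions. *)
Definition rich_part H v := \bigcup_(F : {set {set V}} | (F \subset H) && rich v F) F.

Lemma rich_part_sub H v : rich_part H v \subset H.
Proof. by apply/bigcupsP => F /andP[]. Qed.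

Lemma rich_sub_part H v F : F \subset H -> rich v F -> F \subset rich_part H v.
Proof. by move=> FH rF; apply: (bigcup_sup F) => //; rewrite FH. Qed.

Lemma rich_partP H v e : e \in rich_part H v -> v \in e /\
  forall D, v \in D -> D \proper e -> kernel k (rich_part H v) D.
Proof.
case/bigcupP=> F /andP[FH rF] eF; move: (rF) => /forall_inP /(_ e eF) /andP[ve].
move=> /forallP hD; split=> // D vD De.
apply: kernelS (rich_sub_part FH rF) _.
by move: (hD D); rewrite vD De.
Qed.

End Rich.

(** The constant multiplies the loss of the rainbow colouring by that of at most 2^r rounds of the
    homogeneous reduction. *)
Lemma poor_edges_bound (V : finType) (H : hypergraph V) (a b s h k : nat) :
  1 < a -> 1 < b -> 4 < a + b -> 0 < s -> uniform (a + b) H ->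
  a + s * b + a * (s * h) < k -> a + b < k ->
  ~ contains H (bush a b s h) ->
  #|H :\: \bigcup_v rich_part k H v| <=
    (a + b) ^ (a + b) * (2 ^ (a + b).+1 * ((a + b) * k)).+2 ^ (2 ^ (a + b)) *
    #|V| ^ (a + b - 2).
Proof.
set r := a + b => a1 b1 r5 s0 uH k1 k2 nb.
set P := H :\: _.
have uP e : e \in P -> #|e| = r by rewrite inE => /andP[_ /uH].
have r0 : 0 < r by lia.
have [chi leF] := rainbow_subfamily r0 uP.
set F := [set e in P | _] in leF.
have rF : rainbow chi F.
  move=> e; rewrite inE => /andP[/uP ce /dinjectiveP]; by split.
have nT : setT \notin [set~ setT : {set 'I_r}] by rewrite !inE eqxx.
have [|F' [JJ [F'F leF' nT' sF' spF']]] := homogeneous_subfamily k rF nT.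
  (* Initially only the full colour set must be sparse: distinct edges of equal size are not
     nested. *)
  move=> J; rewrite !inE negbK => /eqP -> e e' eF e'F.
  apply: contra => /eqP; rewrite -(chi_onto rF eF).
  rewrite -(proj_chi rF eF (subxx e)) => ee'.
  by rewrite eqEcard -{1}ee' subsetIr (rF _ eF).1 (rF _ e'F).1 leqnn.
apply: leq_trans leF _; rewrite -mulnA leq_mul2l; apply/orP; right.
apply: leq_trans leF' _; apply: leq_mul.
  rewrite leq_exp2l //; apply: leq_trans (max_card _) _.
  by rewrite -cardsT -powersetT card_powerset cardsT card_ord.
have rF' : rainbow chi F' := rainbowS F'F rF.
have F'H : F' \subset H.
  apply: subset_trans F'F _; apply/subsetP => e; rewrite !inE.
  by case/andP=> /andP[_].
rewrite leqNgt; apply/negP => big.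
have F'0 : 0 < #|F'| by apply: leq_ltn_trans big.
have [|||||||[J [cJ JJJ CJ]]|[c hc]] := @intersection_closed_dichotomy a b r JJ => //.
- by move=> J1 J2; apply: (saturated_setI k2 rF').
- move=> T cT; apply/exists_inP; apply: contraT; rewrite negb_exists_in => /forall_inP h'.
  have := uncovered_bound rF' spF' h'; rewrite cT leqNgt => /negP; case.
  exact: leq_ltn_trans (bin_le_expn _ _) big.
(* Complementary [J]: the J-part of [e] is A, and the petals B_i at it are parts for [~: J], hence
   kernels. *)
- have [e eF'] := card_gt0P F'0; apply: nb.
  have /kernelP [Q [kQ tQ hQ]] := sF' e J eF' JJJ.
  have sQ : s <= #|Q|.
    apply: leq_trans kQ; apply: ltnW; apply: leq_ltn_trans k1.
    by apply: leq_trans (leq_addr _ _); apply: leq_trans (leq_addl _ _); rewrite leq_pmulr //; lia.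
  have [Q' Q'Q cQ'] := subset_card_ex sQ.
  have [B Bi eQ'] := set_param cQ'.
  have BQ i : B i \in Q by apply: (subsetP Q'Q); rewrite eQ' imset_f.
  have BF i := (hQ _ (BQ i)).2.
  have dB i := (hQ _ (BQ i)).1.
  have pA : #|proj chi e J| = a by rewrite (card_proj J rF' eF').
  apply: (@contains_bush V H a b s h k (proj chi e J) B) => //.
  + by lia.
  + move=> i; have := uH _ (subsetP F'H _ (BF i)).
    rewrite cardsU disjoint_setI0 1?disjoint_sym // cards0 pA /r; lia.
  + by move=> i; rewrite disjoint_sym.
  + move=> i j ij; move/trivIsetP: tQ; apply => //.
    by apply: contra ij => /eqP /Bi ->.
  + by move=> i; apply: (subsetP F'H).
  + move=> i; apply: (kernelS F'H).
    suff -> : B i = proj chi (proj chi e J :|: B i) (~: J) by apply: sF'.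
    have pJ : proj chi (proj chi e J :|: B i) J = proj chi e J.
      by apply: (proj_eq rF' eF' (BF i)); apply: subsetUl.
    apply/setP => x; move/setP/(_ x): pJ; have := disjointFr (dB i) (x := x).
    rewrite !inE; case: (x \in B i); case: (chi x \in J); case: (x \in e) => //= h1 h2;
    do ?[by rewrite h1 | by rewrite h2].
(* Star at [c]: with [v] the vertex of colour [c] in [e], the edges of [F'] through [v] form a rich
   family, so [e] was not poor. *)
- have [e eF'] := card_gt0P F'0.
  have : c \in chi @: e by rewrite (chi_onto rF' eF') inE.
  case/imsetP=> v ve cv.
  pose Fv := [set e' in F' | v \in e'].
  have FvF : Fv \subset F' by apply/subsetP => e'; rewrite inE => /andP[].
  have rv : rich k v Fv.
    apply/forall_inP => e'; rewrite inE => /andP[e'F ve']; rewrite ve' /=.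
    apply/forallP => D; apply/implyP => /andP[vD /andP[De' nD]].
    have cD : c \in chi @: D by rewrite cv imset_f.
    have : chi @: D != setT.
      apply: contra nD => /eqP DT.
      by rewrite (proj_chi rF' e'F De') DT -(chi_onto rF' e'F) -(proj_chi rF' e'F (subxx e')).
    move=> /(hc _ cD) /(sF' _ _ e'F); rewrite -(proj_chi rF' e'F De').
    move=> /kernelP [Q [kQ tQ hQ]]; apply/kernelP; exists Q; split=> // p /hQ [dp pF].
    by split=> //; rewrite inE pF inE vD.
  have := subsetP F'F e eF'; rewrite !inE => /andP[/andP[/negP nG _] _]; apply: nG.
  apply/bigcupP; exists v => //.
  apply: (subsetP (rich_sub_part (subset_trans FvF F'H) rv)).
  by rewrite inE eF' ve.
Qed.

(* For s such vertices v the kernel v + A provides edges A + B_v with pairwise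
   disjoint B_v through v, and each B_v is again a kernel. *)
Lemma few_centres (V : finType) (H : hypergraph V) (a b s h k : nat) (A : {set V}) :
  0 < a -> 1 < b -> uniform (a + b) H ->
  a + s * b + a * (s * h) < k -> a + s + (a + b) * s < k ->
  ~ contains H (bush a b s h) -> #|A| = a ->
  #|[set v | [exists e in rich_part k H v, (v \notin A) && (A \subset e)]]| < s.
Proof.
move=> a0 b1 uH k1 k2 nb cA; rewrite ltnNge; apply/negP => sS; apply: nb.
have [S SS cS] := subset_card_ex sS.
have [g gi eS] := set_param cS.
have /fin_all_exists [e he] i : exists e,
    [/\ e \in rich_part k H (g i), g i \notin A & A \subset e].
  have : g i \in S by rewrite eS imset_f.
  by move/(subsetP SS); rewrite inE => /exists_inP [e eG /andP[gA Ae]]; exists e.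
have uG i e' : e' \in rich_part k H (g i) -> #|e'| = a + b.
  by move/(subsetP (rich_part_sub _ _ _)) => /uH.
have cD i : #|g i |: A| = a.+1 by case: (he i) => _ gA _; rewrite cardsU1 gA cA.
have /fin_all_exists [P hP] i : exists P : {set {set V}}, [/\ k <= #|P|, trivIset P &
    forall p, p \in P -> [disjoint p & g i |: A] /\
      (g i |: A) :|: p \in rich_part k H (g i)].
  apply/kernelP; case: (he i) => eG gA Ae.
  have [ge ker] := rich_partP eG; apply: ker; first exact: setU11.
  rewrite properEcard subUset sub1set ge Ae cD (uG _ _ eG); lia.
have cP i p : p \in P i -> #|p| = b.-1.
  case: (hP i) => _ _ hp /hp [dp /uG].
  rewrite cardsU disjoint_setI0 1?disjoint_sym // cards0 cD; lia.
(* The petals avoid all the centres as well, so that the sets [g i |: p i] are disjoint. *)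
have [|||p [pP pX pp]] := @disjoint_representatives V 'I_s P (A :|: [set g i | i : 'I_s]) (a + b).
- by move=> i; case: (hP i).
- by move=> i p /cP ->; lia.
- move=> i; case: (hP i) => kP _ _; apply: leq_trans kP; apply: leq_ltn_trans k2.
  rewrite card_ord leq_add2r; apply: (leq_trans (leq_card_setU _ _)).
  by rewrite cA leq_add2l (leq_trans (leq_imset_card _ _)) // card_ord.
have gp i j : g i \notin p j.
  by rewrite (disjointFl (pX j)) // inE imset_f ?orbT.
have gA i : g i \notin A by case: (he i).
have pA i : [disjoint p i & A] by apply: disjointWr (pX i); apply: subsetUl.
have E i : A :|: (g i |: p i) = (g i |: A) :|: p i by rewrite setUCA setUA.
have EG i : A :|: (g i |: p i) \in rich_part k H (g i).
  by rewrite E; case: (hP i) => _ _ /(_ _ (pP i)) [].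
have cB i : #|g i |: p i| = b by rewrite cardsU1 gp (cP _ _ (pP i)); lia.
have dis i : [disjoint A & g i |: p i].
  rewrite disjoint_sym -setI_eq0 setIUl (disjoint_setI0 (pA i)) setU0 setI_eq0.
  by rewrite disjoints1 gA.
apply: (@contains_bush V H a b s h k A (fun i => g i |: p i)) => //.
- by lia.
- move=> i j ij; rewrite -setI_eq0 setIUl !setIUr (disjoint_setI0 (pp i j ij)) setU0.
  rewrite -subset0; apply/subsetP => x; rewrite !inE.
  case/orP; [case/orP|] => /andP[] => [/eqP -> /eqP /gi ij'|/eqP ->|+ /eqP xj].
  + by rewrite ij' eqxx in ij.
  + by rewrite (negPf (gp _ _)).
  + by rewrite xj (negPf (gp _ _)).
- by move=> i; apply: (subsetP (rich_part_sub _ _ _)) (EG i).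
- move=> i; apply: (kernelS (rich_part_sub k H (g i))).
  have [ge ker] := rich_partP (EG i); apply: ker; first exact: setU11.
  rewrite properEcard subsetUr cB (uG _ _ (EG i)); lia.
Qed.

(** * Exchanging coordinates one at a time *)

Section Hybrids.

Variables (V : finType) (m : nat).
Implicit Types (x y : {ffun 'I_m.+1 -> V}) (T : {set V}).

Definition hybrid (i : nat) x y : {ffun 'I_m.+1 -> V} :=
  [ffun j : 'I_m.+1 => if j < i then y j else x j].

(** A prefix exchange is reversible; hence a given tuple is the [i]-th hybrid of at most n^(m+1)
    pairs. *)
Lemma hybrid_inj i : injective (fun xy : {ffun 'I_m.+1 -> V} * {ffun 'I_m.+1 -> V} =>
  (hybrid i xy.1 xy.2, hybrid i xy.2 xy.1)).
Proof.
move=> [x y] [x' y'] /= [/ffunP h1 /ffunP h2]; congr pair; apply/ffunP => j;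
by move: (h1 j) (h2 j); rewrite !ffunE; case: ifP.
Qed.

Lemma hybrid0 x y : hybrid 0 x y = x.
Proof. by apply/ffunP => j; rewrite ffunE. Qed.

Lemma hybrid_full x y : hybrid m.+1 x y = y.
Proof. by apply/ffunP => j; rewrite ffunE ltn_ord. Qed.

Lemma hybridS i x y (j : 'I_m.+1) : (j : nat) != i ->
  hybrid i.+1 x y j = hybrid i x y j.
Proof. by rewrite !ffunE ltnS leq_eqVlt => /negbTE ->. Qed.

Variables (X : eqType) (S : {set V} -> X) (full : pred {set V}) (D : nat).
(** The factor [m.+2] counts the hybrids of a pair; the bracket bounds the non-injective tuples plus
    the at most [m.+1 ^ m.+1] tuples on each set that is not [full]. *)
Let E := m.+2 * (m.+1 ^ 2 + D * m.+1 ^ m.+1).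

(** Consecutive good hybrids share [m] points, so [S] is constant along a chain of them. On average
    over [x], only O(n^m) tuples [y] have a bad hybrid with [x]. *)
Lemma almost_constant :
  (forall T T', full T -> full T' -> #|T| = m.+1 -> #|T'| = m.+1 ->
     m <= #|T :&: T'| -> S T = S T') ->
  #|[set T : {set V} | (#|T| == m.+1) && ~~ full T]| <= D * #|V| ^ m ->
  E < #|V| ->
  exists T0, [/\ #|T0| = m.+1, full T0 &
    #|[set T : {set V} | (#|T| == m.+1) && ~~ (full T && (S T == S T0))]|
      <= E * #|V| ^ m].
Proof.
move=> agree few big; set n := #|V| in few big *.
pose good x := injectiveb x && full (x @: setT).
pose bad := [set x | ~~ good x].
have cbad : #|bad| <= (m.+1 ^ 2 + D * m.+1 ^ m.+1) * n ^ m.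
  rewrite mulnDl; pose B2 := [set x : {ffun 'I_m.+1 -> V} | injectiveb x && ~~ full (x @: setT)].
  have sub : bad \subset ~: [set x : {ffun 'I_m.+1 -> V} | injectiveb x] :|: B2.
    apply/subsetP => x; rewrite !inE negb_and.
    by case: (injectiveb x).
  apply: leq_trans (subset_leq_card sub) _; apply: leq_trans (leq_card_setU _ _) _.
  apply: leq_add.
    have := cardsC [set x : {ffun 'I_m.+1 -> V} | injectiveb x].
    rewrite card_inj_ffuns card_ffun !card_ord -/n => h.
    by have := expn_le_ffact n m; rewrite -h leq_add2l.
  apply: (@leq_trans (\sum_(T in [set T : {set V} | (#|T| == m.+1) && ~~ full T]) m.+1 ^ m.+1)).
    apply: (@leq_trans (\sum_(T in [set T : {set V} | (#|T| == m.+1) && ~~ full T])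
       \sum_(x : {ffun 'I_m.+1 -> V} | (x \in B2) && (x @: setT == T)) 1)).
      rewrite -sum1_card (partition_big (fun x : {ffun 'I_m.+1 -> V} => x @: setT)
        (mem [set T : {set V} | (#|T| == m.+1) && ~~ full T])) //.
      move=> x; rewrite !inE => /andP[/injectiveP xi ->].
      by rewrite card_imset // cardsT card_ord eqxx.
    apply: leq_sum => T; rewrite inE => /andP[/eqP cT _].
    have -> : m.+1 ^ m.+1 = #|ffun_on T : pred {ffun 'I_m.+1 -> V}|.
      by rewrite card_ffun_on card_ord cT.
    rewrite sum1dep_card.
    apply/subset_leq_card/subsetP => x; rewrite !inE => /andP[_ /eqP <-].
    by apply/ffun_onP => j; apply: imset_f.
  by rewrite sum_nat_const mulnAC leq_mul2r few orbT.
pose pbad x y := [exists i : 'I_m.+2, hybrid i x y \in bad].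
have pairs : \sum_x #|[set y | pbad x y]| <= m.+2 * #|bad| * n ^ m.+1.
  pose Q (i : 'I_m.+2) := [set xy : {ffun 'I_m.+1 -> V} * {ffun 'I_m.+1 -> V} |
    hybrid i xy.1 xy.2 \in bad].
  have cQ i : #|Q i| <= #|bad| * n ^ m.+1.
    rewrite -(card_imset _ (hybrid_inj (i := i))).
    have -> : n ^ m.+1 = #|[set: {ffun 'I_m.+1 -> V}]|.
      by rewrite cardsT card_ffun card_ord.
    rewrite -cardsX; apply/subset_leq_card/subsetP => _ /imsetP [[x y] + ->] /=.
    by rewrite !inE /= andbT.
  apply: (@leq_trans (\sum_(i < m.+2) #|Q i|)); last first.
    apply: (leq_trans (leq_sum _ (fun i _ => cQ i))).
    by rewrite sum_nat_const card_ord mulnA.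
  under eq_bigr do rewrite -sum1dep_card.
  rewrite pair_big_dep /= sum1dep_card.
  apply: (@leq_trans #|\bigcup_i Q i|).
    apply/subset_leq_card/subsetP => -[x y]; rewrite inE /= => /existsP [i hi].
    by apply/bigcupP; exists i => //; rewrite inE.
  elim/big_ind2 : _ => [|A p B q hp hq|] //; first by rewrite cards0.
  by apply: (leq_trans (leq_card_setU _ _)); apply: leq_add.
have leE : m.+2 * #|bad| <= E * n ^ m by rewrite /E -mulnA leq_mul2l cbad orbT.
have n0 : 0 < n by apply: leq_ltn_trans big.
have [x hx] : exists x, #|[set y | pbad x y]| <= E * n ^ m.
  apply/existsP; apply: contraT; rewrite negb_exists => /forallP h.
  have : \sum_(x : {ffun 'I_m.+1 -> V}) (E * n ^ m).+1 <= \sum_x #|[set y | pbad x y]|.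
    by apply: leq_sum => x _; rewrite ltnNge h.
  rewrite sum_nat_const card_ffun card_ord -/n => h1.
  have := leq_trans h1 pairs; rewrite mulnC leq_pmul2r ?expn_gt0 ?n0 //.
  by rewrite ltnNge leE.
have pgood y : ~~ pbad x y -> forall i, i <= m.+1 -> good (hybrid i x y).
  rewrite negb_exists => /forallP h i; rewrite -ltnS => lti.
  by have := h (Ordinal lti); rewrite inE negbK.
have goodc z : good z -> full (z @: setT) /\ #|z @: setT| = m.+1.
  by case/andP=> /injectiveP zi fz; rewrite card_imset // cardsT card_ord.
have key y : ~~ pbad x y -> good y /\ S (y @: setT) = S (x @: setT).
  move=> /pgood h; split; first by have := h m.+1 (leqnn _); rewrite hybrid_full.
  have : forall i, i <= m.+1 -> S (hybrid i x y @: setT) = S (x @: setT).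
    elim=> [|i IH] lti; first by rewrite hybrid0.
    rewrite -(IH (ltnW lti)).
    have [f1 c1] := goodc _ (h _ lti); have [f2 c2] := goodc _ (h _ (ltnW lti)).
    apply: agree => //; pose j := Ordinal lti.
    have /andP[/injectiveP hi _] := h _ lti.
    apply: (@leq_trans #|hybrid i.+1 x y @: [set~ j]|).
      by rewrite card_imset // cardsC1 card_ord.
    apply/subset_leq_card/subsetP => _ /imsetP [l lj ->].
    rewrite inE imset_f //= hybridS ?imset_f //.
    by move: lj; rewrite !inE.
  by move=> /(_ m.+1 (leqnn _)); rewrite hybrid_full.
(* As [E < n], some [y] has only good hybrids with [x]; the hybrid of index 0 shows that [x] is
   good. *)
have [y ny] : exists y, ~~ pbad x y.
  apply/existsP; apply: contraT; rewrite negb_exists => /forallP h.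
  have : #|[set: {ffun 'I_m.+1 -> V}]| <= #|[set y | pbad x y]|.
    by apply/subset_leq_card/subsetP => y _; rewrite inE; move: (h y); rewrite negbK.
  rewrite cardsT card_ffun card_ord -/n => h1; have := leq_trans h1 hx.
  by rewrite expnS leq_pmul2r ?expn_gt0 ?n0 // leqNgt big.
have gx : good x by have := pgood y ny 0 isT; rewrite hybrid0.
have [fx cx] := goodc _ gx.
(* Every exceptional set is the image of some [y] with [pbad x y]. *)
exists (x @: setT); split=> //; apply: leq_trans hx.
apply: leq_trans (leq_imset_card (fun y : {ffun 'I_m.+1 -> V} => y @: setT) _).
apply/subset_leq_card/subsetP => T; rewrite inE => /andP[/eqP cT nT].
have [g gi eT] := set_param cT.
have eT' : T = finfun g @: setT.
  by rewrite eT; apply/setP => z; apply/imsetP/imsetP => -[i _ ->];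
    exists i; rewrite ?ffunE ?inE.
rewrite eT' imset_f // inE; apply: contraT => /key [gy Sy].
have [fT _] := goodc _ gy.
by move: nT; rewrite eT' fT Sy eqxx.
Qed.

End Hybrids.

(** * Counting extremal sets and vertex degrees *)

Lemma large_degree_vertices (a b s h K : nat) :
  0 < s -> 1 < a -> 1 < b -> 4 < a + b ->
  exists E, forall (V : finType) (H : hypergraph V),
    E < #|V| -> uniform (a + b) H -> ~ contains H (bush a b s h) ->
    (s - 1) * 'C(#|V|, a + b - 1) <= #|H| + K * #|V| ^ (a + b - 2) ->
    exists S : {set V}, #|S| = s - 1 /\
      forall v, v \in S ->
        'C(#|V|, a + b - 1) <= degree H v + E * #|V| ^ (a + b - 2).
Proof.
move=> s0 a1 b1 r5.
have [m rm] : exists m, a + b = m.+2 by exists (a + b - 2); lia.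
pose k := (a + s * b + a * (s * h) + s + (a + b) * s + (a + b)).+1.
pose C := (a + b) ^ (a + b) * (2 ^ (a + b).+1 * ((a + b) * k)).+2 ^ (2 ^ (a + b)).
(* [C] accounts for the edges in no rich part and [K] for the deficit allowed in [#|H|]. *)
pose D := C + K.
exists (m.+2 * (m.+1 ^ 2 + D * m.+1 ^ m.+1)) => V H big uH nb lH.
have [k1 [k2 k3]] : a + s * b + a * (s * h) < k /\ a + s + (a + b) * s < k /\ a + b < k.
  by rewrite /k; split; [|split]; lia.
have poor := poor_edges_bound a1 b1 r5 s0 uH k1 k3 nb.
have few := fun A => @few_centres V H a b s h k A (ltnW a1) b1 uH k1 k2 nb.
rewrite -/C in poor.
have r1 : a + b - 1 = m.+1 by lia.
have r2 : a + b - 2 = m by lia.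
rewrite r1 r2 in lH poor *.
pose G := rich_part k H.
pose S (T : {set V}) := [set v | (v \notin T) && (v |: T \in G v)].
have SA (A T : {set V}) : A \subset T ->
    S T \subset [set v | [exists e in G v, (v \notin A) && (A \subset e)]].
  move=> AT; apply/subsetP => v; rewrite !inE => /andP[vT vG].
  apply/exists_inP; exists (v |: T) => //.
  rewrite (contra _ vT) /=; last exact: (subsetP AT).
  by apply: subset_trans AT (subsetUr _ _).
have Sle (T : {set V}) : #|T| = m.+1 -> #|S T| <= s - 1.
  move=> cT; have [|A AT cA] := @subset_card_ex _ T a; first by rewrite cT; lia.
  have := leq_ltn_trans (subset_leq_card (SA A T AT)) (few A cA); lia.
pose full (T : {set V}) := #|S T| == s - 1.
(* For a common a-subset [A], both values lie in the set of fewer than [s] centres of [A], and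
   extremality makes them equal to it. *)
have agree (T T' : {set V}) : full T -> full T' -> #|T| = m.+1 -> #|T'| = m.+1 ->
    m <= #|T :&: T'| -> S T = S T'.
  move=> fT fT' cT cT' cTT; have [|A AT cA] := @subset_card_ex _ (T :&: T') a.
    by apply: leq_trans cTT; lia.
  move: AT; rewrite subsetI => /andP[AT AT'].
  have fA (U : {set V}) : A \subset U -> full U ->
      S U = [set v | [exists e in G v, (v \notin A) && (A \subset e)]].
    move=> AU /eqP cU; apply/eqP; rewrite eqEcard (SA A U AU) cU.
    by have := few A cA; rewrite -/G; lia.
  by rewrite (fA T) // (fA T').
have sumS : #|\bigcup_v G v| <= \sum_(T : {set V} | #|T| == m.+1) #|S T|.
  rewrite [X in _ <= X](eq_bigr (fun T => \sum_(v in S T) 1)) => [|T _]; last by rewrite sum1_card.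
  rewrite [X in _ <= X]pair_big_dep /= sum1dep_card.
  apply: leq_trans (leq_imset_card (fun Tv : {set V} * V => Tv.2 |: Tv.1) _).
  apply/subset_leq_card/subsetP => e /bigcupP [v _ eG].
  have [ve _] := rich_partP eG.
  have ce : #|e| = m.+2 by rewrite -rm; apply: uH; apply: (subsetP (rich_part_sub k H v)).
  apply/imsetP; exists (e :\ v, v); last by rewrite /= setD1K.
  rewrite !inE /= eqxx setD1K // eG /=.
  by have := cardsD1 v e; rewrite ve ce add1n => -[<-]; rewrite eqxx.
(* Each non-extremal set loses at least 1 from the maximum [(s - 1) * 'C(#|V|, m.+1)] of the sum in
   [sumS]. *)
have nonfull : #|[set T : {set V} | (#|T| == m.+1) && ~~ full T]| <= D * #|V| ^ m.
  have le1 : \sum_(T : {set V} | #|T| == m.+1) #|S T| +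
      \sum_(T : {set V} | #|T| == m.+1) ~~ full T <= (s - 1) * 'C(#|V|, m.+1).
    rewrite -big_split /= mulnC -card_draws -sum_nat_cond_const.
    apply: leq_sum => T /eqP cT.
    have := Sle T cT; rewrite /full; case: eqP => /=; lia.
  have -> : #|[set T : {set V} | (#|T| == m.+1) && ~~ full T]| =
      \sum_(T : {set V} | #|T| == m.+1) ~~ full T.
    rewrite -sum1_card big_mkcond [RHS]big_mkcond; apply: eq_bigr => T _ /=.
    by rewrite inE; case: (_ == _); case: (full T).
  have : #|H| <= #|\bigcup_v G v| + #|H :\: \bigcup_v G v|.
    rewrite -(cardsID (\bigcup_v G v) H) leq_add2r.
    by apply: subset_leq_card; apply: subsetIr.
  rewrite /D mulnDl; move: poor sumS le1 lH; rewrite -/G; lia.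
have [T0 [cT0 fT0 few0]] := almost_constant agree nonfull big.
exists (S T0); split; first exact/eqP.
move=> v vS; rewrite -card_draws.
apply: leq_trans (_ : #|[set T : {set V} | (#|T| == m.+1) && (full T && (S T == S T0))]| +
  #|[set T : {set V} | (#|T| == m.+1) && ~~ (full T && (S T == S T0))]| <= _).
  rewrite -cardsUI; apply: leq_trans (leq_addr _ _).
  apply/subset_leq_card/subsetP => T; rewrite !inE => -> /=; apply: orbN.
apply: leq_add few0.
(* Sets with value [S T0] avoid [v], so adding [v] maps them injectively to edges through [v]. *)
rewrite -(@card_in_imset _ _ (fun T => v |: T)).
  apply/subset_leq_card/subsetP => _ /imsetP [T + ->].
  rewrite !inE => /and3P[_ _ /eqP ST]; rewrite eqxx andbT.
  move: vS; rewrite -ST inE => /andP[_ vG].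
  exact: (subsetP (rich_part_sub k H v)).
have nv (T : {set V}) : S T == S T0 -> v \notin T.
  by move=> /eqP ST; move: vS; rewrite -ST inE => /andP[].
move=> T T'; rewrite !inE => /and3P[_ _ /nv vT] /and3P[_ _ /nv vT'] eTT.
by rewrite -(setU1K vT) -(setU1K vT') eTT.
Qed.

Local Open Scope ring_scope.

Theorem theorem5 (R : realType) (a b s h r : nat)
  (hs : (2 <= s)%N) (hh : (0 < h)%N) (ha : (2 <= a)%N) (hb : (2 <= b)%N)
  (hr : r = (a + b)%N) (hr5 : (5 <= r)%N) :
  forall C0 : R, 0 < C0 ->
  exists n0 : nat, (0 < n0)%N /\
  exists C1 : R, 0 < C1 /\
  forall (n : nat) (H : hypergraph 'I_n),
    (n0 < n)%N ->
    uniform r H ->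
    ~ contains H (bush a b s h) ->
    #|H|%:R > (s - 1)%:R * 'C(n, r - 1)%:R - C0 * n%:R ^+ (r - 2) ->
    exists S : {set 'I_n},
      #|S| = (s - 1)%N /\
      forall v : 'I_n, v \in S ->
        (degree H v)%:R >= 'C(n, r - 1)%:R - C1 * n%:R ^+ (r - 2).
Proof.
move=> C0 C0_gt0; rewrite hr in hr5 *.
have [K C0K] : exists K : nat, C0 <= K%:R.
  by exists (Num.bound C0); apply/ltW/archi_boundP/ltW.
have [E hE] := @large_degree_vertices a b s h K (ltnW hs) ha hb hr5.
(* The successor makes both constants positive. *)
exists E.+1; split=> //; exists E.+1%:R; split; first by rewrite ltr0n.
move=> n H nE uH nb lH.
have [||S [cS hS]] := hE _ H _ uH nb; rewrite ?card_ord //.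
- exact: ltnW.
- rewrite -(ler_nat R) natrD !natrM natrX -lerBlDr; apply/ltW/(le_lt_trans _ lH).
  by rewrite lerB // ler_wpM2r // exprn_ge0.
exists S; split=> // v /hS; rewrite card_ord -(ler_nat R) natrD natrM natrX => le.
rewrite lerBlDr; apply: le_trans le _; rewrite lerD2l ler_wpM2r ?exprn_ge0 //.
by rewrite ler_nat.
Qed.
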